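(* Let $\mathcal{L}$ be a non-trivial finite atomistic lattice. Let $A \subseteq B \subseteq \mathrm{At}(\mathcal{L})$, and let $S \subseteq \mathcal{L}(B)$ be any subset. For all $x \in \mathcal{L}(A)$ we have $$\sum_{z \in \mathcal{L}(A) \cap S} \mu_A(x,z)= \sum_{\substack{t \in \mathcal{L}(B) \\ t^A=x}} \ \sum_{\substack{y \in S \\ y \ge t}}\mu_B(t,y).$$
   Context: A lattice is non-trivial if it has more than one element. $\mathrm{At}(\mathcal{L})$ is the set of atoms of $\mathcal{L}$; $\mathcal{L}$ is atomistic if every nonzero element is a join of atoms (no gradedness is assumed). For a possibly empty $A\subseteq\mathrm{At}(\mathcal{L})$, $\mathcal{L}(A)$ is the set of elements of $\mathcal{L}$ that are joins (in $\mathcal{L}$) of some elements of $A$, together with $0\in\mathcal{L}$, with the order induced by $\mathcal{L}$ (it is a lattice); $\mu_A$ denotes its Möbius function, with the usual convention $\mu_A(x,z)=0$ if $x\not\le z$. For $x\in\mathcal{L}$, $x^A=\bigvee(\{a\in A\mid a\le x\}\cup\{0\})$, the largest element of $\mathcal{L}(A)$ that is $\le x$. *)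

(* Defs.v *)
From HB Require Import structures.
From mathcomp Require Import all_boot all_order all_algebra.

Set Implicit Arguments.
Unset Strict Implicit.
Unset Printing Implicit Defensive.

Import Order.TTheory GRing.Theory.
Local Open Scope ring_scope.

Section Mobius.
Variables (d : Order.disp_t) (T : finPOrderType d).
Implicit Types (P : {set T}) (x y z : T).

(* The recursion on z is well founded because < is; the fuel #|T| bounds the
   length of every chain. See [mobiusxx], [mobius_nle] and [mobius_sum]. *)
Fixpoint mobius_rec P (n : nat) x z : int :=
  if n is n'.+1 then
    if x == z then 1
    else if (x < z)%O then
      - \sum_(y in P | (x <= y)%O && (y < z)%O) mobius_rec P n' x y
    else 0
  else 0.

(* The Möbius function of the poset P with the order induced by T; it is only
   meaningful at elements of P. *)
Definition mobius P x z : int := mobius_rec P #|T| x z.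

Lemma mobius_rec_stable P m n x z :
  (#|[set y | (y <= z)%O]| <= m)%N -> (#|[set y | (y <= z)%O]| <= n)%N ->
  mobius_rec P m x z = mobius_rec P n x z.
Proof.
have z_gt0 (u : T) : (0 < #|[set y | (y <= u)%O]|)%N.
  by apply/card_gt0P; exists u; rewrite inE.
elim: m n z => [|m IHm] [|n] z lem len.
- by [].
- by have := leq_trans (z_gt0 z) lem.
- by have := leq_trans (z_gt0 z) len.
rewrite /=; case: eqP => // _; case: ifP => // _; congr (- _).
apply: eq_bigr => y /andP[_ /andP[_ ltyz]].
have lt_card : (#|[set u | (u <= y)%O]| < #|[set u | (u <= z)%O]|)%N.
  apply/proper_card/properP; split.
    by apply/subsetP=> u; rewrite !inE => /le_trans; apply; apply: ltW.
  by exists z; rewrite !inE ?lexx // lt_geF.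
by apply: IHm; rewrite -ltnS; apply: leq_trans lt_card _.
Qed.

Lemma mobiusE P x z :
  mobius P x z =
    if x == z then 1
    else if (x < z)%O then
      - \sum_(y in P | (x <= y)%O && (y < z)%O) mobius P x y
    else 0.
Proof.
rewrite /mobius (@mobius_rec_stable P #|T| #|T|.+1) ?max_card //.
exact: leqW (max_card _).
Qed.

Lemma mobiusxx P x : mobius P x x = 1.
Proof. by rewrite mobiusE eqxx. Qed.

Lemma mobius_nle P x z : ~~ (x <= z)%O -> mobius P x z = 0.
Proof.
by move=> nle_xz; rewrite mobiusE; case: comparableP nle_xz.
Qed.

Lemma mobius_sum P x z : z \in P -> (x < z)%O ->
  \sum_(y in P | (x <= y)%O && (y <= z)%O) mobius P x y = 0.
Proof.
move=> Pz lt_xz; rewrite (bigD1 z) /=; last by rewrite Pz (ltW lt_xz) lexx.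
rewrite mobiusE lt_eqF // lt_xz addrC; apply/eqP; rewrite subr_eq0; apply/eqP.
apply: eq_bigl => y; rewrite -!andbA; congr (_ && (_ && _)).
by rewrite lt_neqAle andbC.
Qed.

End Mobius.

Section AtomisticLattice.
Variables (d : Order.disp_t) (L : finTBLatticeType d).
Implicit Types (A : {set L}) (x : L).

Definition atoms : {set L} :=
  [set a : L | (\bot < a)%O && ~~ [exists y : L, (\bot < y < a)%O]].

Definition atomistic : Prop :=
  forall x : L, x != \bot%O ->
    exists2 C : {set L}, C \subset atoms & x = (\join_(a in C) a)%O.

(* L(A); the bottom element is included as the join of C = set0. *)
Definition joins_of A : {set L} :=
  [set (\join_(a in C) a)%O | C : {set L} in powerset A].

(* x^A; it is \bot when no element of A lies below x. *)
Definition lower_join A x : L := (\join_(a in A | (a <= x)%O) a)%O.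

End AtomisticLattice.

Arguments atoms {d} L.
Arguments atomistic {d} L.

(* Main.v *)
Require Import Defs.
From mathcomp Require Import all_boot all_order all_algebra.

Set Implicit Arguments.
Unset Strict Implicit.
Unset Printing Implicit Defensive.

Import Order.TTheory GRing.Theory.
Local Open Scope ring_scope.

(** Both sides are additive in [S], so everything reduces to one element [y] of
    [L(B)], where the claim is that the sum of [mu_B(t, y)] over the [t] with
    [t^A = x] equals [mu_A(x, y)] if [y] lies in [L(A)] and [0] otherwise.

    The map [t |-> t^A] is right adjoint to the inclusion of [L(A)] in [L(B)]:
    an element [z] of [L(A)] is below [t^A] iff it is below [t]
    ([le_lower_join]).  Hence the defining property of [mu_A]
    ([mobius_sum_below]) expands the indicator of [t^A = x] as the sum of
    [mu_A(x, z)] over the [z] in [L(A)] with [z <= t].  After exchanging sums,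
    the coefficient of [mu_A(x, z)] is the sum of [mu_B(t, y)] over the [t >= z]
    in [L(B)], which vanishes unless [z = y]: this is the dual recursion of the
    Möbius function ([mobius_sum_above]), that is, the fact that the left
    inverse [mu] of the zeta function is also a right inverse. *)

Section MobiusTheory.
Variables (d : Order.disp_t) (T : finPOrderType d).
Implicit Types (P : {set T}) (x y z : T).

Lemma sum_delta (V : pzSemiRingType) P (Q : pred T) x : x \in P ->
  \sum_(y in P | Q y) (x == y)%:R = (Q x)%:R :> V.
Proof.
move=> Px; rewrite big_mkcond (bigD1 x) //= Px eqxx big1 ?addr0.
  by case: (Q x).
by move=> y ne_yx; rewrite eq_sym (negPf ne_yx) if_same.
Qed.

(** The terms with [y] not above [x] vanish, so this is the recursion that
    defines [mu]: it says that [mu] is a left inverse of zeta. *)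
Lemma mobius_sum_below P x z : x \in P -> z \in P ->
  \sum_(y in P | (y <= z)%O) mobius P x y = (x == z)%:R.
Proof.
move=> Px Pz; rewrite (bigID (fun y => x <= y)%O) /= [X in _ + X]big1 ?addr0.
  rewrite (eq_bigl (fun y => (y \in P) && ((x <= y)%O && (y <= z)%O))).
    2: by move=> y; rewrite -andbA [(y <= z)%O && _]andbC.
  have [<-|ne_xz] := eqVneq x z.
    rewrite (big_pred1 x) ?mobiusxx // => y /=.
    rewrite -eq_le eq_sym.
    by case: eqVneq => [->|]; rewrite ?Px ?andbF.
  have [le_xz|nle_xz] := boolP (x <= z)%O.
    by apply: mobius_sum; rewrite // lt_neqAle ne_xz.
  rewrite big1 // => y /and3P[_ le_xy le_yz].
  by rewrite (le_trans le_xy le_yz) in nle_xz.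
by move=> y /andP[_]; apply: mobius_nle.
Qed.

(** The zeta function of a finite poset is unitriangular, so summation over
    lower sets is injective. *)
Lemma lower_sum_inj (V : zmodType) P (f g : T -> V) :
    (forall z, z \in P ->
      \sum_(y in P | (y <= z)%O) f y = \sum_(y in P | (y <= z)%O) g y) ->
  {in P, f =1 g}.
Proof.
move=> eq_fg z.
have [n] := ubnP #|[set u | (u <= z)%O]|; elim: n z => // n IHn z le_n Pz.
have := eq_fg z Pz.
rewrite (bigD1 z) ?Pz ?lexx //= [X in _ = X](bigD1 z) ?Pz ?lexx //=.
rewrite (eq_bigr g) => [/addIr //|y /andP[/andP[Py le_yz] ne_yz]].
apply: IHn => //; rewrite ltnS in le_n; apply: leq_trans le_n.
apply/proper_card/properP; split.
  by apply/subsetP=> u; rewrite !inE => /le_trans; apply.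
by exists z; rewrite !inE ?lexx // lt_geF // lt_neqAle ne_yz.
Qed.

(** Writing [G] for the product of zeta and [mu], the identity [mu * zeta = 1]
    gives [G * zeta = zeta = 1 * zeta], and zeta can be cancelled on the
    right. *)
Lemma mobius_sum_above P x z : x \in P -> z \in P ->
  \sum_(t in P | (x <= t)%O) mobius P t z = (x == z)%:R.
Proof.
move=> Px; move: z.
apply: (@lower_sum_inj _ P
  (fun y => \sum_(t in P | (x <= t)%O) mobius P t y)
  (fun y => (x == y)%:R : int)) => z Pz.
rewrite exchange_big /= sum_delta //.
under eq_bigr => t /andP[Pt _] do rewrite mobius_sum_below // eq_sym.
exact: sum_delta.
Qed.

End MobiusTheory.

Section LowerJoin.
Variables (d : Order.disp_t) (L : finTBLatticeType d).
Implicit Types (A B : {set L}) (t z : L).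

Lemma joins_ofS A B : A \subset B -> joins_of A \subset joins_of B.
Proof. by move=> sAB; apply: imsetS; rewrite powersetS. Qed.

Lemma lower_join_in A t : lower_join A t \in joins_of A.
Proof.
apply/imsetP; exists [set a in A | (a <= t)%O].
  by rewrite powersetE; apply/subsetP=> a; rewrite inE => /andP[].
by apply: eq_bigl => a; rewrite inE.
Qed.

(** An element [z] of [L(A)] is a join of elements of [A]; if [z <= t], each of
    them is one of the terms of the join that defines [t^A]. *)
Lemma le_lower_join A t z : z \in joins_of A ->
  (z <= lower_join A t)%O = (z <= t)%O.
Proof.
case/imsetP=> C; rewrite powersetE => /subsetP sCA ->.
apply/idP/idP=> [/le_trans|/joinsP le_t].
  by apply; apply/joinsP=> a /andP[].
by apply/joinsP=> a Ca; apply: (joins_sup id); rewrite sCA //= le_t.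
Qed.

End LowerJoin.

(** This is the theorem for [S] reduced to [y]: the indicator of [t^A = x] is
    expanded over [L(A)] with [mu_A], and the sums are exchanged. *)
Lemma sum_mobius_lower_join (d : Order.disp_t) (L : finTBLatticeType d)
    (A B : {set L}) (x y : L) :
    A \subset B -> x \in joins_of A -> y \in joins_of B ->
  \sum_(t in joins_of B | lower_join A t == x) mobius (joins_of B) t y =
  if y \in joins_of A then mobius (joins_of A) x y else 0.
Proof.
move=> sAB xA yB; have /subsetP sLAB := joins_ofS sAB.
transitivity (\sum_(t in joins_of B) \sum_(z in joins_of A | (z <= t)%O)
    mobius (joins_of A) x z * mobius (joins_of B) t y).
  rewrite big_mkcondr; apply: eq_bigr => t _; rewrite -mulr_suml.
  (* For [z] in [L(A)], [z <= t] is the same as [z <= t^A]. *)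
  rewrite -(eq_bigl _ _ (fun z => andb_id2l (@le_lower_join _ _ A t z))).
  rewrite mobius_sum_below ?lower_join_in // eq_sym.
  by case: eqP => _; rewrite ?mul1r ?mul0r.
rewrite (exchange_big_dep (mem (joins_of A))) /=; last by move=> t z _ /andP[].
transitivity (\sum_(z in joins_of A) mobius (joins_of A) x z * (y == z)%:R).
  apply: eq_bigr => z zA; rewrite zA /= -mulr_sumr.
  by rewrite mobius_sum_above 1?eq_sym // sLAB.
rewrite big_mkcond (bigD1 y) //= eqxx mulr1 big1 ?addr0 // => z ne_zy.
by rewrite eq_sym (negPf ne_zy) mulr0 if_same.
Qed.

Theorem theorem2p3 (d : Order.disp_t) (L : finTBLatticeType d)
    (L_nontrivial : (1 < #|L|)%N) (L_atomistic : atomistic L)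
    (A B S : {set L}) (sAB : A \subset B) (sB : B \subset atoms L)
    (sS : S \subset joins_of B) (x : L) (xA : x \in joins_of A) :
  \sum_(z in joins_of A :&: S) mobius (joins_of A) x z =
  \sum_(t in joins_of B | lower_join A t == x)
    \sum_(y in S | (t <= y)%O) mobius (joins_of B) t y.
Proof.
transitivity (\sum_(y in S) \sum_(t in joins_of B | lower_join A t == x)
    mobius (joins_of B) t y).
  rewrite (eq_bigl (fun z => (z \in S) && (z \in joins_of A))); last first.
    by move=> z; rewrite inE andbC.
  rewrite big_mkcondr; apply: eq_bigr => y Sy.
  by rewrite sum_mobius_lower_join // (subsetP sS).
rewrite exchange_big; apply: eq_bigr => t _.
(* Adding the terms with [y] not above [t] is harmless: there [mu_B] is 0. *)
rewrite [RHS]big_mkcondr; apply: eq_bigr => y _.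
by case: ifPn => // /mobius_nle.
Qed.
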